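(* Let $2\le a<b<c$ be pairwise relatively prime integers, $S=\langle ab,ac,bc\rangle$, $S'=\langle ab,ac,bc,abc+1\rangle$, and $\mathbf{r}=(ab,ac,bc)$. Let $\gamma,\beta,\alpha$ be the unique integers with $1\le\gamma\le c-1$ and $\gamma ab\equiv 1\pmod c$; $1\le\beta\le b-1$ and $\beta ac\equiv 1\pmod b$; $1\le\alpha\le a-1$ and $\alpha bc\equiv 1\pmod a$. Suppose $abc+1\notin S$. Then $$g(S')=g(S)-(a-\alpha)(b-\beta)(c-\gamma).$$ In this case, $$g(S(\mathbf{r}))\le abc-\frac{ab+ac+bc-1}{2}-(a-\alpha)(b-\beta)(c-\gamma),$$ where $S(\mathbf{r})$ is the generic semigroup adapted to $\mathbf{r}$.
   Context: $\mathbb{N}=\{0,1,2,\dots\}$, and $\langle n_1,\dots,n_s\rangle$ denotes the set of $\mathbb{N}$-linear combinations of $n_1,\dots,n_s$. The genus $g(S)$ of a numerical semigroup $S$ is the cardinality of $\mathbb{N}\setminus S$. $v_t$ is the $t$-adic valuation on $\mathbb{C}[[t]]$. Generic semigroup adapted to $\mathbf{r}=(r_1,r_2,r_3)$ with $0<r_1<r_2<r_3$: let $f_i(t)=\sum_{n\ge r_i} a_{i,n}t^n\in\mathbb{C}[[t]]$ $(i=1,2,3)$ be power series with fixed nonzero lowest-order coefficients $a_{i,r_i}$ and generic higher-order coefficients, i.e. the coefficients $a_{i,n}$ with $n>r_i$, $i=1,2,3$, are algebraically independent over $\mathbb{Q}(a_{1,r_1},a_{2,r_2},a_{3,r_3})$.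 The generic semigroup adapted to $\mathbf{r}$ is $S(\mathbf{r})=\{v_t(G(f_1,f_2,f_3)) : G\in\mathbb{C}[x_1,x_2,x_3],\ G(f_1,f_2,f_3)\ne 0\}$. *)

(* Defs.v *)
From HB Require Import structures.
From mathcomp Require Import all_boot all_order all_algebra.
From mathcomp Require Import finmap complex.
From mathcomp Require Import boolp classical_sets cardinality reals.
From mathcomp Require Import mpoly.

Set Implicit Arguments.
Unset Strict Implicit.
Unset Printing Implicit Defensive.

Import GRing.Theory.
Local Open Scope classical_set_scope.
Local Open Scope ring_scope.

Definition semigroup_gen (s : seq nat) : set nat :=
  [set x | exists k : 'I_(size s) -> nat,
     x = (\sum_(i < size s) k i * nth 0 s i)%N].

Definition numerical_semigroup (S : set nat) : Prop :=
  [/\ S 0%N, (forall x y, S x -> S y -> S (x + y)%N) & finite_set (~` S)].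

(* [fset_set] is empty on infinite sets, so this is the genus only when the
   complement of [S] is finite, e.g. when [numerical_semigroup S]. *)
Definition genus (S : set nat) : nat := #|` fset_set (~` S)|%fset.

(* The ring K[[t]].  A record is used because the function type [nat -> K]
   already carries the pointwise operations. *)
Record fps (K : Type) := Fps { fps_coef : nat -> K }.

HB.instance Definition _ (K : Type) := gen_eqMixin (fps K).
HB.instance Definition _ (K : Type) := gen_choiceMixin (fps K).

Section FpsRing.
Variable K : comNzRingType.
Implicit Types f g h : fps K.

Lemma fpsP f g : (forall n, fps_coef f n = fps_coef g n) <-> f = g.
Proof.
split=> [|->] //; case: f g => [f] [g] /= fg.
by congr Fps; apply: funext.
Qed.

Definition fps_const (c : K) : fps K := Fps (fun n => if n == 0%N then c else 0).
Definition fps_add f g := Fps (fun n => fps_coef f n + fps_coef g n).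
Definition fps_opp f := Fps (fun n => - fps_coef f n).
Definition fps_mul f g :=
  Fps (fun n => \sum_(i < n.+1) fps_coef f i * fps_coef g (n - i)%N).

Fact fps_addA : associative fps_add.
Proof. by move=> f g h; apply/fpsP=> n /=; rewrite addrA. Qed.

Fact fps_addC : commutative fps_add.
Proof. by move=> f g; apply/fpsP=> n /=; rewrite addrC. Qed.

Fact fps_add0 : left_id (fps_const 0) fps_add.
Proof. by move=> f; apply/fpsP=> n /=; rewrite if_same add0r. Qed.

Fact fps_addN : left_inverse (fps_const 0) fps_opp fps_add.
Proof. by move=> f; apply/fpsP=> n /=; rewrite if_same addNr. Qed.

HB.instance Definition _ :=
  GRing.isZmodule.Build (fps K) fps_addA fps_addC fps_add0 fps_addN.

Fact fps_mul_rev f g n :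
  \sum_(i < n.+1) fps_coef f i * fps_coef g (n - i)%N =
  \sum_(i < n.+1) fps_coef f (n - i)%N * fps_coef g i.
Proof.
rewrite (reindex_inj rev_ord_inj) /=.
by apply: eq_bigr => i _; rewrite (sub_ordK i).
Qed.

Fact fps_mulA : associative fps_mul.
Proof.
move=> f g h; apply/fpsP=> n /=; rewrite [RHS](fps_mul_rev (fps_mul f g) h n) /=.
pose F j k := fps_coef f j * (fps_coef g (n - j - k)%N * fps_coef h k).
transitivity (\sum_(j < n.+1) \sum_(k < n.+1 | (k <= n - j)%N) F j k).
  apply: eq_bigr => /= j _; rewrite fps_mul_rev big_distrr /=.
  by rewrite (big_ord_narrow_leq (leq_subr _ _)).
rewrite (exchange_big_dep predT) //=; apply: eq_bigr => k _.
transitivity (\sum_(j < n.+1 | (j <= n - k)%N) F j k).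
  apply: eq_bigl => j; rewrite -ltnS -(ltnS j) -!subSn ?leq_ord //.
  by rewrite -subn_gt0 -(subn_gt0 j) -!subnDA addnC.
rewrite (big_ord_narrow_leq (leq_subr _ _)) big_distrl /=.
by apply: eq_bigr => j _; rewrite /F -!subnDA addnC mulrA.
Qed.

Fact fps_mulC : commutative fps_mul.
Proof.
move=> f g; apply/fpsP=> n /=; rewrite fps_mul_rev.
by apply: eq_bigr => i _; rewrite mulrC.
Qed.

Fact fps_mul1 : left_id (fps_const 1) fps_mul.
Proof.
move=> f; apply/fpsP=> n /=; rewrite big_ord_recl /= mul1r subn0.
by rewrite big1 ?addr0 // => i _; rewrite mul0r.
Qed.

Fact fps_mulDl : left_distributive fps_mul fps_add.
Proof.
move=> f g h; apply/fpsP=> n /=; rewrite -big_split /=.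
by apply: eq_bigr => i _; rewrite mulrDl.
Qed.

Fact fps_1neq0 : fps_const 1 != 0 :> fps K.
Proof. by apply/eqP=> /fpsP/(_ 0%N)/= /eqP; rewrite oner_eq0. Qed.

HB.instance Definition _ := GRing.Zmodule_isComNzRing.Build (fps K)
  fps_mulA fps_mulC fps_mul1 fps_mulDl fps_1neq0.

Definition fps_eval n (f : 'I_n -> fps K) (G : {mpoly K[n]}) : fps K :=
  mmap fps_const f G.

(* The [t]-adic valuation, with the arbitrary value 0 at the zero series. *)
Definition fps_val f : nat :=
  if pselect (exists n, fps_coef f n != 0) is left ex_n then ex_minn ex_n
  else 0%N.

End FpsRing.

(* The smallest subfield containing [A]; in characteristic 0 this is Q(A). *)
Definition generated_field (K : fieldType) (A : set K) : set K :=
  [set x | forall F : {pred K}, GRing.divring_closed F ->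
     (forall y, A y -> y \in F) -> x \in F].

Definition alg_independent (K : fieldType) (F : set K) (I : Type) (D : set I)
    (x : I -> K) : Prop :=
  forall (m : nat) (e : 'I_m -> I), injective e -> (forall k, D (e k)) ->
  forall P : {mpoly K[m]}, (forall u, F P@_u) ->
    P.@[fun k => x (e k)] = 0 -> P = 0.

Definition generic_series (K : fieldType) (r : 3.-tuple nat)
    (f : 'I_3 -> fps K) : Prop :=
  [/\ forall i n, (n < tnth r i)%N -> fps_coef (f i) n = 0,
      forall i, fps_coef (f i) (tnth r i) != 0
    & alg_independent
        (generated_field (range (fun i => fps_coef (f i) (tnth r i))))
        [set p : 'I_3 * nat | (tnth r p.1 < p.2)%N]
        (fun p => fps_coef (f p.1) p.2)].

Definition value_semigroup (K : fieldType) (f : 'I_3 -> fps K) : set nat :=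
  [set n | exists G : {mpoly K[3]},
     fps_eval f G != 0 /\ n = fps_val (fps_eval f G)].

(* Main.v *)
From HB Require Import structures.
Require Import Defs.
From mathcomp Require Import all_boot all_order all_algebra.
From mathcomp Require Import complex boolp classical_sets reals.
From mathcomp Require Import finmap cardinality mpoly.
From mathcomp Require Import zify ring lra.

(** Write comb x y z for x * bc + y * ac + z * ab.  Modulo abc every integer is
congruent to exactly one comb x y z with digits x < a, y < b, z < c, so that
n = comb x y z + k * abc for a unique integer k; and n lies in
S = <ab, ac, bc> exactly when k >= 0, because replacing x by x + a (or y by
y + b, or z by z + c) adds one full abc ([mem_gen]).  To stay within the
natural numbers, k is represented as a difference i - j.

The reflection n |-> F - n, with F = 2abc - ab - ac - bc, complements the
digits and sends k to -1 - k.  Hence it exchanges S with its gaps in [0, F],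
while everything above F lies in S, and 2 g(S) = F + 1 ([genus_gen]).

The inverses alpha, beta, gamma are the digits of 1, hence also of abc + 1.
Since comb alpha beta gamma is congruent to 1 modulo abc, exceeds 1 and is
smaller than 3abc, it is abc + 1 or 2abc + 1; the first case would put abc + 1
in S, so abc + 1 = comb alpha beta gamma - abc ([comb_inverses]).
Consequently an element of S plus abc + 1 escapes S only if it has k = 0 and
the addition of (alpha, beta, gamma) to its digits produces no carry; there
are (a - alpha)(b - beta)(c - gamma) such digits.  No two of the doubled
digits 2 alpha, 2 beta, 2 gamma are small enough to avoid a carry, so
2(abc + 1) is in S already, and higher multiples of abc + 1 bring nothing new
([adjoinP], [genus_adjoin]).

For generic series f_1, f_2, f_3 of orders ab, ac, bc, the powers f_1^c and
f_2^b both have order abc.  Cancelling their leading terms leaves, up to a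
nonzero factor, the t^(abc+1)-coefficient
c lc(f_2) a_{1,ab+1} - b lc(f_1) a_{2,ac+1}, where lc is the leading
coefficient.  This is a nonzero linear form over the field generated by the
leading coefficients, evaluated at two numbers algebraically independent over
that field; it cannot vanish ([generic_cancellation]).  So S' is contained in
S(r), and the genus of S(r) is at most that of S'. *)

Set Implicit Arguments.
Unset Strict Implicit.
Unset Printing Implicit Defensive.
Import GRing.Theory Num.Theory.
Local Open Scope ring_scope.

(** * Genera as counts of gaps below a bound *)

Lemma cofinite_set (T : set nat) N :
  (forall n, (N <= n)%N -> T n) -> finite_set (~` T)%classic.
Proof.
move=> TN; apply: (sub_finite_set _ (finite_II N)) => n /= nT.
by rewrite ltnNge; apply/negP => /TN.
Qed.

Lemma genus_count (T : set nat) N : (forall n, (N <= n)%N -> T n) ->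
  genus T = count (fun n => `[< ~ T n >]) (iota 0 N).
Proof.
move=> TN; rewrite /genus -size_filter; apply: (@perm_size _ (enum_fset _)).
apply: uniq_perm; rewrite ?fset_uniq ?filter_uniq ?iota_uniq // => n.
rewrite in_fset_set; last exact: cofinite_set TN.
rewrite mem_filter mem_iota /= add0n; apply/idP/andP => [|[/asboolP nT _]].
  rewrite in_setE /= => nT; split; first exact: nT.
  by rewrite ltnNge; apply/negP => /TN.
by rewrite in_setE.
Qed.

Lemma leq_genus (T T' : set nat) N : (forall n, (N <= n)%N -> T n) ->
  (T `<=` T')%classic -> (genus T' <= genus T)%N.
Proof.
move=> TN TT'; rewrite (genus_count TN) (@genus_count T' N) => [|n /TN/TT'//].
by apply: sub_count => n /asboolP nT'; apply/asboolP => /TT'.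
Qed.

Lemma genusD_count (T T' : set nat) N : (forall n, (N <= n)%N -> T n) ->
  (T `<=` T')%classic ->
  genus T = (genus T' + count (fun n => `[< T' n /\ ~ T n >]) (iota 0 N))%N.
Proof.
move=> TN TT'; rewrite (genus_count TN) (@genus_count T' N) => [|n /TN/TT'//].
rewrite -count_predUI [X in (_ = _ + X)%N](@eq_count _ _ pred0).
  rewrite count_pred0 addn0; apply: eq_count => n /=.
  apply/asboolP/orP => [nT|[/asboolP nT' /TT'//|/asboolP[]//]].
  by have [T'n|nT'n] := pselect (T' n); [right|left]; apply/asboolP.
by move=> n /=; apply/negP => /andP[/asboolP ? /asboolP[]].
Qed.

(** The reflection n |-> F - n turns gaps into elements, so exactly half of the
F + 1 numbers up to F are gaps. *)
Lemma genus_symmetric (T : set nat) F : (forall n, (F < n)%N -> T n) ->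
  (forall n, (n <= F)%N -> T (F - n)%N <-> ~ T n) ->
  (2 * genus T = F.+1)%N.
Proof.
move=> TF symT; rewrite (genus_count TF) mul2n -addnn.
rewrite -[RHS](size_iota 0) -(count_predC (fun n => `[< ~ T n >])).
congr addn.
have permF : perm_eq (iota 0 F.+1) [seq (F - n)%N | n <- iota 0 F.+1].
  apply: uniq_perm; rewrite ?iota_uniq ?map_inj_in_uniq ?iota_uniq //.
    by move=> m n; rewrite !mem_iota; lia.
  move=> n; rewrite mem_iota; apply/idP/mapP => [nF|[m]].
    by exists (F - n)%N; rewrite ?mem_iota; lia.
  by rewrite mem_iota; lia.
rewrite (permP permF) count_map; apply: eq_in_count => n.
rewrite mem_iota /= => nF; have nF' : (n <= F)%N by lia.
by apply/asboolP/asboolPn; have := symT _ nF'; tauto.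
Qed.

(** * The semigroup generated by ab, ac and bc *)

Lemma semigroup_gen3P p q r n : semigroup_gen [:: p; q; r] n <->
  exists x y z, n = (x * p + y * q + z * r)%N.
Proof.
split=> [[k ->]|[x [y [z ->]]]].
  exists (k ord0), (k (lift ord0 ord0)), (k (lift ord0 (lift ord0 ord0))).
  by rewrite !big_ord_recl big_ord0 /= addn0 addnA.
exists (fun i => nth 0%N [:: x; y; z] i).
by rewrite !big_ord_recl big_ord0 /= addn0 addnA.
Qed.

Lemma semigroup_gen4P p q r s n : semigroup_gen [:: p; q; r; s] n <->
  exists x y z w, n = (x * p + y * q + z * r + w * s)%N.
Proof.
split=> [[k ->]|[x [y [z [w ->]]]]].
  exists (k ord0), (k (lift ord0 ord0)), (k (lift ord0 (lift ord0 ord0))).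
  exists (k (lift ord0 (lift ord0 (lift ord0 ord0)))).
  by rewrite !big_ord_recl big_ord0 /= addn0 !addnA.
exists (fun i => nth 0%N [:: x; y; z; w] i).
by rewrite !big_ord_recl big_ord0 /= addn0 !addnA.
Qed.

Lemma semigroup_gen0 s : semigroup_gen s 0%N.
Proof. by exists (fun=> 0%N); rewrite big1. Qed.

Lemma semigroup_genD s m n :
  semigroup_gen s m -> semigroup_gen s n -> semigroup_gen s (m + n)%N.
Proof.
case=> k -> [l ->]; exists (fun i => k i + l i)%N.
by rewrite -big_split /=; apply: eq_bigr => i _; rewrite mulnDl.
Qed.

Section Products.
Variables a b c : nat.
Hypotheses (a_gt0 : (0 < a)%N) (b_gt0 : (0 < b)%N) (c_gt0 : (0 < c)%N).
Hypotheses (cop_ab : coprime a b) (cop_ac : coprime a c) (cop_bc : coprime b c).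
Local Notation S := (semigroup_gen [:: a * b; a * c; b * c]%N).
Local Notation comb x y z := (x * (b * c) + y * (a * c) + z * (a * b))%N.

Lemma genP n : S n <-> exists x y z, n = comb x y z.
Proof.
rewrite semigroup_gen3P; split=> -[x [y [z ->]]]; exists z, y, x; lia.
Qed.

(** Reducing modulo p, the invertible factor q cancels, and u is the residue of
v.  This is how the digits of a combination are recovered. *)
Lemma eq_digit p q d e u v : coprime p q -> (u < p)%N ->
  (v * q + d * p = u * q + e * p)%N -> exists k, v = (u + k * p)%N.
Proof.
move=> cop_pq up E; have [uv|vu] := leqP u v.
  have /dvdnP[k Ek] : (p %| v - u)%N.
    rewrite -(Gauss_dvdl _ cop_pq) mulnBl; apply/dvdnP.
    by exists (e - d)%N; rewrite mulnBl; lia.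
  by exists k; lia.
have /dvdn_leq : (p %| u - v)%N; last lia.
rewrite -(Gauss_dvdl _ cop_pq) mulnBl; apply/dvdnP.
by exists (d - e)%N; rewrite mulnBl; lia.
Qed.

(** A combination with arbitrary coefficients differs from the one with the same
value modulo abc and small digits only by carries, each of which costs one
abc. *)
Lemma normal_form x y z i x' y' z' j : (x < a)%N -> (y < b)%N -> (z < c)%N ->
  (comb x' y' z' + j * (a * b * c) = comb x y z + i * (a * b * c))%N ->
  exists p q r, [/\ x' = x + p * a, y' = y + q * b, z' = z + r * c
                  & j + (p + q + r) = i]%N.
Proof.
move=> xa yb zc E.
have [||p Ep] := @eq_digit a (b * c)
  (y' * c + z' * b + j * b * c) (y * c + z * b + i * b * c) x x' _ xa.
- by rewrite coprimeMr cop_ab.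
- lia.
have [||q Eq] := @eq_digit b (a * c)
  (x' * c + z' * a + j * a * c) (x * c + z * a + i * a * c) y y' _ yb.
- by rewrite coprimeMr coprime_sym cop_ab.
- lia.
have [||r Er] := @eq_digit c (a * b)
  (x' * b + y' * a + j * a * b) (x * b + y * a + i * a * b) z z' _ zc.
- by rewrite coprimeMr coprime_sym cop_ac coprime_sym.
- lia.
exists p, q, r; split=> //; apply/eqP.
have abc0 : (0 < a * b * c)%N by rewrite !muln_gt0 a_gt0 b_gt0.
by rewrite -(eqn_pmul2r abc0); apply/eqP; move: E; rewrite Ep Eq Er; lia.
Qed.

(** The excess i - j over the small combination is the integer k whose sign
decides membership. *)
Lemma mem_gen n x y z i j : (x < a)%N -> (y < b)%N -> (z < c)%N ->
  (n + j * (a * b * c) = comb x y z + i * (a * b * c))%N -> S n <-> (j <= i)%N.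
Proof.
move=> xa yb zc E; rewrite genP; split=> [[x' [y' [z' En]]]|ji].
  by move: E; rewrite En => /normal_form[]// p [q [r [_ _ _ <-]]]; lia.
move: E; rewrite -(subnKC ji); move: (i - j)%N => d E.
by exists (x + d * a)%N, y, z; lia.
Qed.

Section Unit.
Variables alpha beta gamma k : nat.
Hypothesis combE : comb alpha beta gamma = (k * (a * b * c) + 1)%N.

(** Multiplying the expression of 1 modulo abc by n and reducing the
coefficients yields the digits of n. *)
Lemma normal_form_ex n : exists x y z i j, [/\ x < a, y < b, z < c &
  n + j * (a * b * c) = comb x y z + i * (a * b * c)]%N.
Proof.
exists ((n * alpha) %% a)%N, ((n * beta) %% b)%N, ((n * gamma) %% c)%N.
exists ((n * alpha) %/ a + (n * beta) %/ b + (n * gamma) %/ c)%N, (n * k)%N.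
split; rewrite ?ltn_mod //.
transitivity (n * comb alpha beta gamma)%N; first by rewrite combE; lia.
have := divn_eq (n * alpha) a; have := divn_eq (n * beta) b.
have := divn_eq (n * gamma) c.
move: (_ %/ _)%N (_ %% _)%N => u u' Eu.
move: (_ %/ _)%N (_ %% _)%N => v v' Ev.
move: (_ %/ _)%N (_ %% _)%N => w w' Ew.
transitivity (comb (n * alpha) (n * beta) (n * gamma))%N; first lia.
rewrite Eu Ev Ew; lia.
Qed.

Variable F : nat.
Hypothesis F_E : (F + (a * b + a * c + b * c) = 2 * (a * b * c))%N.

(** The largest digits give F + abc, that is, F has the largest digits and
k = -1. *)
Lemma combF : comb a.-1 b.-1 c.-1 = (F + a * b * c)%N.
Proof.
move: F_E; case: a a_gt0 b b_gt0 c c_gt0 => // ? _ [//|?] _ [//|?] _ /=; lia.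
Qed.

Lemma gt_Frobenius n : (F < n)%N -> S n.
Proof.
move=> Fn; have [x [y [z [i [j [xa yb zc E]]]]]] := normal_form_ex n.
rewrite (mem_gen xa yb zc E) leqNgt; apply/negP => ij.
have : (comb x y z <= comb a.-1 b.-1 c.-1)%N.
  by rewrite !leq_add ?leq_mul //; lia.
have : (i.+1 * (a * b * c) <= j * (a * b * c))%N by rewrite leq_mul.
by rewrite combF; lia.
Qed.

(** F - n has the complementary digits a - 1 - x, b - 1 - y, c - 1 - z and the
excess -1 - k. *)
Lemma gen_symmetric n : (n <= F)%N -> S (F - n)%N <-> ~ S n.
Proof.
move=> Fn; have [x [y [z [i [j [xa yb zc E]]]]]] := normal_form_ex n.
rewrite (mem_gen xa yb zc E).
rewrite (@mem_gen (F - n) (a.-1 - x) (b.-1 - y) (c.-1 - z) j i.+1); try lia.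
have := combF.
have -> : a.-1 = (a.-1 - x + x)%N by lia.
have -> : b.-1 = (b.-1 - y + y)%N by lia.
have -> : c.-1 = (c.-1 - z + z)%N by lia.
rewrite !addnK; lia.
Qed.

Lemma genus_gen :
  (2 * genus S + (a * b + a * c + b * c) = 2 * (a * b * c) + 1)%N.
Proof. by rewrite (genus_symmetric gt_Frobenius gen_symmetric); lia. Qed.
End Unit.

(** * Adjoining abc + 1 *)

Section Adjoin.
Variables alpha beta gamma : nat.
Hypotheses (alpha_a : (alpha < a)%N) (beta_b : (beta < b)%N)
  (gamma_c : (gamma < c)%N).
Hypothesis combE : comb alpha beta gamma = (2 * (a * b * c) + 1)%N.
Local Notation S' := (semigroup_gen [:: a * b; a * c; b * c; a * b * c + 1]%N).

Lemma sub_adjoin : (S `<=` S')%classic.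
Proof.
move=> n /semigroup_gen3P[x [y [z ->]]]; apply/semigroup_gen4P.
by exists x, y, z, 0%N; rewrite mul0n addn0.
Qed.

(** At least two of the inequalities 2 alpha >= a, 2 beta >= b, 2 gamma >= c
hold: if, say, 2 alpha < a and 2 beta < b, then comb alpha beta gamma would be
smaller than 2abc.  The two resulting carries absorb the 2abc by which
2 comb alpha beta gamma exceeds 2(abc + 1). *)
Lemma double_mem_gen : S (2 * (a * b * c + 1))%N.
Proof.
apply/genP.
have Ha : (alpha * (b * c) < a * (b * c))%N.
  by rewrite ltn_pmul2r ?muln_gt0 ?b_gt0.
have Hb : (beta * (a * c) < b * (a * c))%N.
  by rewrite ltn_pmul2r ?muln_gt0 ?a_gt0.
have Hc : (gamma * (a * b) < c * (a * b))%N.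
  by rewrite ltn_pmul2r ?muln_gt0 ?a_gt0.
have [la|ga] := ltnP (2 * alpha) a; have [lb|gb] := ltnP (2 * beta) b.
- have : (2 * alpha * (b * c) <= a * (b * c))%N by rewrite leq_mul2r ltnW ?orbT.
  have : (2 * beta * (a * c) <= b * (a * c))%N.
    by rewrite leq_mul2r ltnW ?orbT.
  by move: combE; lia.
- have [lc|gc] := ltnP (2 * gamma) c.
    have : (2 * alpha * (b * c) <= a * (b * c))%N.
      by rewrite leq_mul2r ltnW ?orbT.
    have : (2 * gamma * (a * b) <= c * (a * b))%N.
      by rewrite leq_mul2r ltnW ?orbT.
    by move: combE; lia.
  exists (2 * alpha)%N, (2 * beta - b)%N, (2 * gamma - c)%N.
  have : (b * (a * c) <= 2 * beta * (a * c))%N by rewrite leq_mul2r gb orbT.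
  have : (c * (a * b) <= 2 * gamma * (a * b))%N by rewrite leq_mul2r gc orbT.
  rewrite !mulnBl; move: combE; lia.
- have [lc|gc] := ltnP (2 * gamma) c.
    have : (2 * beta * (a * c) <= b * (a * c))%N.
      by rewrite leq_mul2r ltnW ?orbT.
    have : (2 * gamma * (a * b) <= c * (a * b))%N.
      by rewrite leq_mul2r ltnW ?orbT.
    by move: combE; lia.
  exists (2 * alpha - a)%N, (2 * beta)%N, (2 * gamma - c)%N.
  have : (a * (b * c) <= 2 * alpha * (b * c))%N by rewrite leq_mul2r ga orbT.
  have : (c * (a * b) <= 2 * gamma * (a * b))%N by rewrite leq_mul2r gc orbT.
  rewrite !mulnBl; move: combE; lia.
exists (2 * alpha - a)%N, (2 * beta - b)%N, (2 * gamma)%N.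
have : (a * (b * c) <= 2 * alpha * (b * c))%N by rewrite leq_mul2r ga orbT.
have : (b * (a * c) <= 2 * beta * (a * c))%N by rewrite leq_mul2r gb orbT.
rewrite !mulnBl; move: combE; lia.
Qed.

(** Since 2(abc + 1) is in S, only the parity of the coefficient of abc + 1
matters. *)
Lemma adjoinP n : S' n <-> S n \/ exists2 m, S m & n = (m + (a * b * c + 1))%N.
Proof.
split=> [/semigroup_gen4P[x [y [z [w ->]]]]|[/sub_adjoin//|[m Sm ->]]].
  have S0 : S (x * (a * b) + y * (a * c) + z * (b * c))%N.
    by apply/semigroup_gen3P; exists x, y, z.
  have Sdouble d : S (d * (2 * (a * b * c + 1)))%N.
    elim: d => [|d IHd]; first exact: semigroup_gen0.
    by rewrite mulSn; apply: semigroup_genD IHd; exact: double_mem_gen.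
  have := semigroup_genD S0 (Sdouble w./2).
  (* The even part of w is absorbed by S. *)
  have := odd_double_half w; move: (w./2) => h.
  case: (odd w) => /= <- Sm; [right|left]; last by apply: eq_ind Sm _ _; lia.
  by eexists; [exact: Sm|lia].
apply: semigroup_genD (sub_adjoin Sm) _; apply/semigroup_gen4P.
by exists 0%N, 0%N, 0%N, 1%N; rewrite !mul0n mul1n.
Qed.

(** Adding abc + 1 adds alpha, beta, gamma to the digits and removes one abc; a
single carry pays for it and brings the sum back into S. *)
Lemma new_elementP n : S' n /\ ~ S n <-> exists x y z,
  [/\ x < a - alpha, y < b - beta, z < c - gamma
    & n = comb x y z + (a * b * c + 1)]%N.
Proof.
split=> [[/adjoinP[//|[m /genP[x [y [z ->]]] ->]] nS]|
  [x [y [z [xa yb zc ->]]]]].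
  exists x, y, z; split=> //; rewrite ltnNge; apply/negP => le; apply: nS;
    apply/genP.
  - exists (x + alpha - a)%N, (y + beta)%N, (z + gamma)%N.
    have : (a * (b * c) <= (x + alpha) * (b * c))%N by rewrite leq_mul2r; lia.
    by rewrite mulnBl; move: combE; lia.
  - exists (x + alpha)%N, (y + beta - b)%N, (z + gamma)%N.
    have : (b * (a * c) <= (y + beta) * (a * c))%N by rewrite leq_mul2r; lia.
    by rewrite mulnBl; move: combE; lia.
  - exists (x + alpha)%N, (y + beta)%N, (z + gamma - c)%N.
    have : (c * (a * b) <= (z + gamma) * (a * b))%N by rewrite leq_mul2r; lia.
    by rewrite mulnBl; move: combE; lia.
split.
  apply/adjoinP; right; exists (comb x y z) => //.
  by apply/genP; exists x, y, z.
by rewrite (@mem_gen _ (x + alpha) (y + beta) (z + gamma) 0 1) //; lia.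
Qed.

Lemma genus_adjoin N : (forall n, (N <= n)%N -> S n) ->
  genus S = (genus S' + (a - alpha) * (b - beta) * (c - gamma))%N.
Proof.
move=> SN; rewrite (genusD_count SN sub_adjoin); congr addn.
pose B := ('I_(a - alpha) * 'I_(b - beta) * 'I_(c - gamma))%type.
pose h (p : B) := (comb p.1.1 p.1.2 p.2 + (a * b * c + 1))%N.
have h_inj : injective h.
  move=> [[x y] z] [[x' y'] z']; rewrite /h /= => E.
  have [xa yb zc] : [/\ x < a, y < b & z < c]%N.
    by split; rewrite (leq_trans (ltn_ord _)) ?leq_subr.
  have [|p [q [r [Ex Ey Ez Ep]]]] := @normal_form x y z 0 x' y' z' 0 xa yb zc.
    by move: E; lia.
  have [p0 q0 r0] : [/\ p = 0, q = 0 & r = 0]%N by split; move: Ep; clear; lia.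
  by congr (_, _, _); apply: val_inj => /=;
    rewrite ?Ex ?Ey ?Ez ?p0 ?q0 ?r0 addn0.
transitivity (size [seq h p | p <- enum {: B}]); last first.
  by rewrite size_map -cardE !card_prod !card_ord.
rewrite -size_filter; apply: perm_size; apply: uniq_perm.
- by rewrite filter_uniq // iota_uniq.
- by rewrite map_inj_uniq // enum_uniq.
move=> n; rewrite mem_filter mem_iota /=; apply/andP/mapP.
  case=> /asboolP/new_elementP[x [y [z [xa yb zc ->]]]] _.
  by exists (Ordinal xa, Ordinal yb, Ordinal zc); rewrite ?mem_enum.
case=> [[[x y] z] _ ->]; have nw : S' (h (x, y, z)) /\ ~ S (h (x, y, z)).
  by apply/new_elementP; exists x, y, z.
split; first exact/asboolP.
by rewrite add0n ltnNge; apply/negP => /SN; case: nw.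
Qed.
End Adjoin.
End Products.

(** * Leading terms of power series *)

Section Jets.
Variable K : comNzRingType.
Implicit Types (f g : fps K) (u v : K).

(** The two lowest coefficients of a series of order at least m.  They multiply
like dual numbers, which makes the second coefficient of a power computable;
u may vanish, which is what a cancellation of leading terms produces. *)
Definition jet f m u v := [/\ forall i, (i < m)%N -> fps_coef f i = 0,
  fps_coef f m = u & fps_coef f m.+1 = v].

Lemma jet_shift f m v : jet f m 0 v -> jet f m.+1 v (fps_coef f m.+2).
Proof.
case=> f0 fm fm1; split=> // i; rewrite ltnS leq_eqVlt.
by case/predU1P => [->|/f0].
Qed.

Lemma jetB f g m u v u' v' : jet f m u v -> jet g m u' v' ->
  jet (f - g) m (u - u') (v - v').
Proof.
case=> f0 fm fm1 [g0 gm gm1]; split=> [i im| |] /=.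
- by rewrite f0 ?g0 ?subr0.
- by rewrite fm gm.
- by rewrite fm1 gm1.
Qed.

Lemma jetM f g m n u v u' v' : jet f m u v -> jet g n u' v' ->
  jet (f * g) (m + n) (u * u') (u * v' + v * u').
Proof.
case=> f0 fm fm1 [g0 gn gn1].
have below i N : (i < m)%N || (N - i < n)%N ->
    fps_coef f i * fps_coef g (N - i)%N = 0.
  by case/orP => [/f0->|/g0->]; rewrite ?mul0r ?mulr0.
split=> [N Nmn| |] /=.
- by apply: big1 => i _; apply: below; have := ltn_ord i; lia.
- have mlt : (m < (m + n).+1)%N by lia.
  rewrite (bigD1 (Ordinal mlt)) //= big1 ?addr0 => [|i /eqP im].
    by rewrite addnC addnK fm gn.
  apply: below; have : nat_of_ord i <> m by move=> e; apply: im; apply: val_inj.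
  have := ltn_ord i; lia.
have mlt : (m < (m + n).+2)%N by lia.
have m1lt : (m.+1 < (m + n).+2)%N by lia.
rewrite (bigD1 (Ordinal mlt)) //= (bigD1 (Ordinal m1lt)) /=; last first.
  by apply/eqP => /(congr1 val) /=; lia.
rewrite big1 ?addr0 => [|i /andP[/eqP im /eqP im1]].
  have -> : ((m + n).+1 - m = n.+1)%N by lia.
  have -> : ((m + n).+1 - m.+1 = n)%N by lia.
  by rewrite fm fm1 gn gn1.
apply: below; have : nat_of_ord i <> m by move=> e; apply: im; apply: val_inj.
have : nat_of_ord i <> m.+1 by move=> e; apply: im1; apply: val_inj.
have := ltn_ord i; lia.
Qed.

Lemma jet_const u : jet (fps_const u) 0 u 0.
Proof. by split. Qed.

Lemma jetX f m u v k : jet f m u v ->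
  jet (f ^+ k) (k * m) (u ^+ k) (k%:R * u ^+ k.-1 * v).
Proof.
move=> fj; elim: k => [|k IHk].
  by rewrite !expr0 !mul0r; exact: jet_const.
rewrite exprS mulSn; have := jetM fj IHk; congr (jet _ _ _ _).
  by rewrite exprS.
case: k {IHk} => [|k] /=; rewrite ?exprS; ring.
Qed.

Lemma jet_val f m u v : jet f m u v -> u != 0 -> f != 0 /\ fps_val f = m.
Proof.
case=> f0 fm _ u0; split.
  apply: contra_neq u0 => f_0; rewrite -fm f_0 /=.
  by case: eqP.
rewrite /fps_val; case: pselect => [ex|[]]; last by exists m; rewrite fm.
case: ex_minnP => n fn n_min; apply/eqP; rewrite eqn_leq n_min ?fm //=.
by rewrite leqNgt; apply: contra_neqN fn => /f0.
Qed.

Lemma val_jet f : f != 0 -> exists2 u, u != 0 &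
  jet f (fps_val f) u (fps_coef f (fps_val f).+1).
Proof.
move=> f_n0; rewrite /fps_val; case: pselect => [ex|[]].
  case: ex_minnP => n fn n_min; exists (fps_coef f n) => //; split=> // i lti.
  by apply/eqP; apply: contraLR lti => /n_min; rewrite -leqNgt.
apply: contrapT => nex; case/eqP: f_n0; apply/fpsP => n; apply: contrapT => fn.
by apply: nex; exists n; apply/eqP => fn0; apply: fn; rewrite fn0 /=; case: eqP.
Qed.

Fact fps_const_is_additive : zmod_morphism (@fps_const K).
Proof.
by move=> u v; apply/fpsP => n /=; case: eqP => _ //; rewrite subr0.
Qed.

Fact fps_const_is_monoid : monoid_morphism (@fps_const K).
Proof.
split=> // u v; apply/fpsP => n /=; rewrite big_ord_recl /= subn0.
rewrite big1 ?addr0 => [|i _]; last by rewrite mul0r.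
by case: eqP => _ //; rewrite mulr0.
Qed.

HB.instance Definition _ :=
  GRing.isZmodMorphism.Build K (fps K) (@fps_const K) fps_const_is_additive.
HB.instance Definition _ :=
  GRing.isMonoidMorphism.Build K (fps K) (@fps_const K) fps_const_is_monoid.

Variables (n : nat) (f : 'I_n -> fps K).

Lemma fps_evalM (G H : {mpoly K[n]}) :
  fps_eval f (G * H) = fps_eval f G * fps_eval f H.
Proof. exact: rmorphM. Qed.

Lemma fps_evalB (G H : {mpoly K[n]}) :
  fps_eval f (G - H) = fps_eval f G - fps_eval f H.
Proof. exact: rmorphB. Qed.

Lemma fps_evalXn (G : {mpoly K[n]}) k : fps_eval f (G ^+ k) = fps_eval f G ^+ k.
Proof. exact: rmorphXn. Qed.

Lemma fps_evalC u : fps_eval f u%:MP = fps_const u.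
Proof. exact: mmapC. Qed.

Lemma fps_evalX i : fps_eval f 'X_i = f i.
Proof. by rewrite /fps_eval mmapX mmap1U. Qed.
End Jets.

(** * The field generated by a set *)

Section Generated.
Variables (K : fieldType) (A : set K).
Local Notation Q := (generated_field A).

Lemma generated_field_sub x : A x -> Q x.
Proof. by move=> Ax F _; apply. Qed.

Lemma generated_field0 : Q 0.
Proof. by move=> F [F1 FB _] _; rewrite -(subrr 1) FB. Qed.

Lemma generated_fieldM x y : Q x -> Q y -> Q (x * y).
Proof.
move=> Qx Qy F cF AF; have [F1 _ FV] := cF.
by rewrite -[y]invrK -[y^-1]div1r !FV ?Qx ?Qy.
Qed.

Lemma generated_fieldN x : Q x -> Q (- x).
Proof.
move=> Qx F cF AF; have [F1 FB _] := cF.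
by rewrite -sub0r FB ?Qx // -(subrr 1) FB.
Qed.

Lemma generated_fieldD x y : Q x -> Q y -> Q (x + y).
Proof.
move=> Qx Qy F cF AF; have [_ FB _] := cF.
by rewrite -[y]opprK FB ?Qx //; apply: generated_fieldN.
Qed.

Lemma generated_field_nat n : Q n%:R.
Proof.
elim: n => [|n IHn]; first exact: generated_field0.
rewrite -natr1; apply: generated_fieldD => // F [F1 _ _] _; exact: F1.
Qed.
End Generated.

(** * The value semigroup of generic series *)

Section ValueSemigroup.
Variables (K : fieldType) (f : 'I_3 -> fps K).
Local Notation V := (value_semigroup f).

Lemma value_jet G m u v : jet (fps_eval f G) m u v -> u != 0 -> V m.
Proof. by move=> Gj /(jet_val Gj)[G0 <-]; exists G. Qed.

Lemma value_semigroup0 : V 0%N.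
Proof.
apply: (@value_jet 1%:MP 0 1 0); last exact: oner_neq0.
by rewrite fps_evalC; exact: jet_const.
Qed.

Lemma value_semigroupD m n : V m -> V n -> V (m + n)%N.
Proof.
case=> G [/val_jet[u u0 Gj] ->] [H [/val_jet[u' u'0 Hj] ->]].
have := jetM Gj Hj; rewrite -fps_evalM => GHj.
by apply: value_jet GHj _; rewrite mulf_neq0.
Qed.

Lemma sub_value_semigroup s : (forall x, x \in s -> V x) ->
  (semigroup_gen s `<=` V)%classic.
Proof.
move=> sV _ [k ->]; apply: (big_ind V) => [||i _].
- exact: value_semigroup0.
- exact: value_semigroupD.
elim: (k i) => [|j IHj]; first exact: value_semigroup0.
by rewrite mulSn; apply: value_semigroupD IHj; apply/sV/mem_nth.
Qed.
End ValueSemigroup.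

Section Generic.
Variables (K : fieldType) (r : 3.-tuple nat) (f : 'I_3 -> fps K).
Hypothesis genf : generic_series r f.
Local Notation V := (value_semigroup f).
Local Notation lc i := (fps_coef (f i) (tnth r i)).
Local Notation nc i := (fps_coef (f i) (tnth r i).+1).

Lemma generic_jet i : jet (f i) (tnth r i) (lc i) (nc i).
Proof. by have [f0 _ _] := genf; split=> // n; apply: f0. Qed.

Lemma generic_value i : V (tnth r i).
Proof.
have [_ lc0 _] := genf.
apply: (@value_jet _ _ 'X_i _ (lc i) (nc i)); rewrite ?fps_evalX ?lc0 //.
exact: generic_jet.
Qed.

(** The coefficients following the leading ones are among the algebraically
independent ones, so that a linear form over the field of the leading
coefficients that vanishes at two of them has zero coefficients. *)
Lemma generic_linear_form i j (x y : K) : i != j ->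
  generated_field (range (fun i => lc i)) x ->
  generated_field (range (fun i => lc i)) y ->
  x * nc i - y * nc j = 0 -> x = 0.
Proof.
move=> ij Qx Qy E; have [_ _ indep] := genf.
pose e (k : 'I_2) :=
  if k == ord0 then (i, (tnth r i).+1) else (j, (tnth r j).+1).
pose P : {mpoly K[2]} := x *: 'X_ord0 - y *: 'X_(lift ord0 ord0).
have P0 : P = 0.
  apply: (indep 2%N e).
  - move=> k l; rewrite /e.
    have two (q : 'I_2) : q != ord0 -> q = lift ord0 ord0.
      by case: q => [[|[|//]] lt2] // _; apply: val_inj.
    by case: eqVneq => [->|/two->]; case: eqVneq => [->|/two->] // [ij'];
      rewrite ij' eqxx in ij.
  - by move=> k; rewrite /e; case: ifP => _ /=.
  - move=> u; rewrite /P mcoeffB !mcoeffZ !mcoeffX.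
    apply: generated_fieldD; last apply: generated_fieldN;
      by apply: generated_fieldM => //; exact: generated_field_nat.
  - by rewrite /P mevalB !mevalZ !mevalXU /e /=.
have := congr1 (mcoeff U_(ord0)) P0.
by rewrite mcoeff0 mcoeffB !mcoeffZ !mcoeffX eqxx eq_mnm1 /= mulr1 mulr0 subr0.
Qed.

(** Subtracting the suitable multiples of two powers of the same order kills the
leading term, and genericity keeps the next one alive, so that the order goes
up by exactly one. *)
Lemma generic_cancellation i j p q : i != j -> (p.+1%:R != 0 :> K) ->
  (p.+1 * tnth r i = q.+1 * tnth r j)%N -> V (p.+1 * tnth r i + 1)%N.
Proof.
move=> ij p0 pq; have [_ lc0 _] := genf.
pose G : {mpoly K[3]} :=
  (lc j ^+ q.+1)%:MP * 'X_i ^+ p.+1 - (lc i ^+ p.+1)%:MP * 'X_j ^+ q.+1.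
have Gj : jet (fps_eval f G) (p.+1 * tnth r i) 0
   (lc i ^+ p * lc j ^+ q *
     ((p.+1%:R * lc j) * nc i - (q.+1%:R * lc i) * nc j)).
  rewrite /G fps_evalB !fps_evalM !fps_evalXn !fps_evalC !fps_evalX.
  have ji := jetM (jet_const (lc j ^+ q.+1)) (jetX p.+1 (generic_jet i)).
  have jj := jetM (jet_const (lc i ^+ p.+1)) (jetX q.+1 (generic_jet j)).
  rewrite !add0n in ji jj; rewrite -pq in jj.
  have := jetB ji jj; congr (jet _ _ _ _); first by rewrite mulrC subrr.
  rewrite /= !mul0r !addr0 !exprS; ring.
have u0 : lc i ^+ p * lc j ^+ q *
     ((p.+1%:R * lc j) * nc i - (q.+1%:R * lc i) * nc j) != 0.
  rewrite !mulf_neq0 ?expf_neq0 ?lc0 //; apply/eqP => /generic_linear_form E.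
  have /eqP : p.+1%:R * lc j = 0.
    by apply: E => //; apply: generated_fieldM; rewrite ?generated_field_nat //;
       try exact: generated_field_nat; apply: generated_field_sub; eexists.
  by rewrite mulf_eq0 (negPf p0) (negPf (lc0 j)).
by rewrite addn1; exact: value_jet (jet_shift Gj) u0.
Qed.
End Generic.

(** * The genus of the generic semigroup *)

Lemma modn_eq1_dvd d m : (0 < m)%N -> (m = 1 %[mod d])%N -> (d %| m - 1)%N.
Proof. by move=> m0 E; rewrite -eqn_mod_dvd //; apply/eqP. Qed.

(** The combination is 1 modulo each of a, b and c, hence modulo abc, and it
lies strictly between 1 and 3abc.  The value abc + 1 is excluded because it
would exhibit abc + 1 as an element of S. *)
Lemma comb_inverses (a b c alpha beta gamma : nat) :
  coprime a b -> coprime a c -> coprime b c ->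
  (0 < alpha < a)%N -> (0 < beta < b)%N -> (0 < gamma < c)%N ->
  (alpha * (b * c) = 1 %[mod a])%N -> (beta * (a * c) = 1 %[mod b])%N ->
  (gamma * (a * b) = 1 %[mod c])%N ->
  ~ semigroup_gen [:: a * b; a * c; b * c]%N (a * b * c + 1)%N ->
  (alpha * (b * c) + beta * (a * c) + gamma * (a * b) = 2 * (a * b * c) + 1)%N.
Proof.
move=> ab ac bc /andP[alpha0 alpha_a] /andP[beta0 beta_b] /andP[gamma0 gamma_c].
have a0 : (0 < a)%N := leq_ltn_trans (leq0n _) alpha_a.
have b0 : (0 < b)%N := leq_ltn_trans (leq0n _) beta_b.
have c0 : (0 < c)%N := leq_ltn_trans (leq0n _) gamma_c.
set W := (_ + gamma * (a * b))%N.
have pa : (0 < alpha * (b * c))%N by rewrite !muln_gt0 alpha0 b0.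
have pb : (0 < beta * (a * c))%N by rewrite !muln_gt0 beta0 a0.
have pc : (0 < gamma * (a * b))%N by rewrite !muln_gt0 gamma0 a0.
have Wa : (W - 1 = (alpha * (b * c) - 1) + a * (beta * c + gamma * b))%N.
  by rewrite /W; lia.
have Wb : (W - 1 = (beta * (a * c) - 1) + b * (alpha * c + gamma * a))%N.
  by rewrite /W; lia.
have Wc : (W - 1 = (gamma * (a * b) - 1) + c * (alpha * b + beta * a))%N.
  by rewrite /W; lia.
move=> Ea Eb Ec nS; have : (a * b * c %| W - 1)%N.
  rewrite !Gauss_dvd ?coprimeMl ?ac //; apply/andP; split.
    apply/andP; split; first by rewrite Wa dvdn_addl ?dvdn_mulr ?modn_eq1_dvd.
    by rewrite Wb dvdn_addl ?dvdn_mulr ?modn_eq1_dvd.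
  by rewrite Wc dvdn_addl ?dvdn_mulr ?modn_eq1_dvd.
clear Ea Eb Ec Wa Wb Wc ab ac bc.
case/dvdnP => k Ek.
have Ha : (alpha * (b * c) < a * (b * c))%N.
  by rewrite ltn_pmul2r ?muln_gt0 ?b0.
have Hb : (beta * (a * c) < b * (a * c))%N.
  by rewrite ltn_pmul2r ?muln_gt0 ?a0.
have Hc : (gamma * (a * b) < c * (a * b))%N.
  by rewrite ltn_pmul2r ?muln_gt0 ?a0.
have k3 : (k < 3)%N.
  have abc0 : (0 < a * b * c)%N by rewrite !muln_gt0 a0 b0.
  by rewrite -(ltn_pmul2r abc0) -Ek /W; lia.
case: k k3 Ek => [|[|[|//]]] _ Ek.
- by move: Ek; rewrite /W; lia.
- case: nS; apply/semigroup_gen3P; exists gamma, beta, alpha.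
  by move: Ek; rewrite /W; lia.
- by move: Ek; rewrite /W; lia.
Qed.

Theorem proposition3p12 (a b c alpha beta gamma : nat)
    (a_ge2 : (2 <= a)%N) (ltab : (a < b)%N) (ltbc : (b < c)%N)
    (cop_ab : coprime a b) (cop_ac : coprime a c) (cop_bc : coprime b c)
    (gamma_bnd : (1 <= gamma <= c - 1)%N)
    (gammaE : (gamma * (a * b) = 1 %[mod c])%N)
    (beta_bnd : (1 <= beta <= b - 1)%N)
    (betaE : (beta * (a * c) = 1 %[mod b])%N)
    (alpha_bnd : (1 <= alpha <= a - 1)%N)
    (alphaE : (alpha * (b * c) = 1 %[mod a])%N) :
  let S := semigroup_gen [:: a * b; a * c; b * c]%N in
  let S' := semigroup_gen [:: a * b; a * c; b * c; a * b * c + 1]%N in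
  let r : 3.-tuple nat := [tuple a * b; a * c; b * c]%N in
  let defect : rat :=
    (a%:R - alpha%:R) * (b%:R - beta%:R) * (c%:R - gamma%:R) in
  ~ S (a * b * c + 1)%N ->
  [/\ numerical_semigroup S,
      numerical_semigroup S',
      (genus S')%:R = (genus S)%:R - defect
    & forall (R : realType) (f : 'I_3 -> fps R[i]), generic_series r f ->
        numerical_semigroup (value_semigroup f) /\
        (genus (value_semigroup f))%:R
          <= a%:R * b%:R * c%:R
             - (a%:R * b%:R + a%:R * c%:R + b%:R * c%:R - 1) / 2%:R - defect].
Proof.
move=> S S' r defect nS.
have a0 : (0 < a)%N := ltnW a_ge2.
have b0 : (0 < b)%N := ltn_trans a0 ltab.
have c0 : (0 < c)%N := ltn_trans b0 ltbc.
have alpha_bnd' : (0 < alpha < a)%N by rewrite -(subnK a0) addn1 ltnS.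
have beta_bnd' : (0 < beta < b)%N by rewrite -(subnK b0) addn1 ltnS.
have gamma_bnd' : (0 < gamma < c)%N by rewrite -(subnK c0) addn1 ltnS.
have combE := comb_inverses cop_ab cop_ac cop_bc alpha_bnd' beta_bnd' gamma_bnd'
  alphaE betaE gammaE nS.
have /andP[_ alpha_a] := alpha_bnd'; have /andP[_ beta_b] := beta_bnd'.
have /andP[_ gamma_c] := gamma_bnd'.
clear alphaE betaE gammaE.
have [F F_E] : exists F, (F + (a * b + a * c + b * c) = 2 * (a * b * c))%N.
  exists (2 * (a * b * c) - (a * b + a * c + b * c))%N; apply: subnK.
  have : (2 * (a * b) <= c * (a * b))%N by rewrite leq_mul2r; lia.
  have : (2 * (a * c) <= b * (a * c))%N by rewrite leq_mul2r; lia.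
  have : (2 * (b * c) <= a * (b * c))%N by rewrite leq_mul2r; lia.
  lia.
have SF : forall n, (F < n)%N -> S n.
  by move=> n; apply: gt_Frobenius combE _ F_E _.
have gS : (2 * genus S + (a * b + a * c + b * c) = 2 * (a * b * c) + 1)%N.
  exact: genus_gen combE _ F_E.
have gS' := genus_adjoin a0 b0 c0 cop_ab cop_ac cop_bc alpha_a beta_b gamma_c
  combE SF.
have SS' : (S `<=` S')%classic by exact: sub_adjoin.
have S'F n : (F < n)%N -> S' n by move/SF/SS'.
have defectE : defect = ((a - alpha) * (b - beta) * (c - gamma))%:R.
  by rewrite /defect !natrM !natrB // ltnW.
have gS'Q : (genus S')%:R = (genus S)%:R - defect :> rat.
  by rewrite gS' defectE natrD addrK.
split=> //; try by split; [exact: semigroup_gen0|exact: semigroup_genD|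
  apply: cofinite_set; eassumption].
move=> R f genf.
have S'V : (S' `<=` value_semigroup f)%classic.
  apply: sub_value_semigroup => x; rewrite !inE => /or4P[] /eqP->.
  - exact: (generic_value genf ord0).
  - exact: (generic_value genf (lift ord0 ord0)).
  - exact: (generic_value genf (lift ord0 (lift ord0 ord0))).
  (* f_1^c and f_2^b both have order abc. *)
  have := @generic_cancellation _ _ _ genf ord0 (lift ord0 ord0) c.-1 b.-1.
  rewrite !prednK // /r /tnth /=.
  have -> : (c * (a * b) = a * b * c)%N by lia.
  apply => //; last lia.
  by rewrite pnatr_eq0; lia.
split.
  split; [exact: value_semigroup0|exact: value_semigroupD|].
  by apply: (@cofinite_set _ F.+1) => n /S'F /S'V.
have -> : a%:R * b%:R * c%:R
   - (a%:R * b%:R + a%:R * c%:R + b%:R * c%:R - 1) / 2%:R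
   - defect = (genus S')%:R :> rat.
  rewrite gS'Q; congr (_ - _); have := congr1 (fun n => n%:R : rat) gS.
  rewrite !natrD !natrM; lra.
by rewrite ler_nat; apply: leq_genus S'F S'V.
Qed.
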